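(* Let $\ell \ge -1$, $r \ge 3$, and \[n \ge \begin{cases} 6\ell+26 & \text{if } r=3\\ \max\{3+ \ell + \frac{4(\ell+2)}{r-3},\,5+\ell+\frac{r+2\ell+7}{2r-2}\} & \text{if } 4 \le r \le 7\\ \ell+5+\frac{4(\ell+4)}{r-4} & \text{if } r \ge 8\end{cases}\] be integers, or let $(\ell,r,n)=(1,8,10)$. Let $G$ be an $n$-vertex, $K_{r+1}$-free graph with degrees $d_1 \le \cdots \le d_n$. If there is an integer $j$ with $1 \le j \le (n-1-\ell)/2$ such that $d_j \le j+\ell$, then \[ e(G) \leq e(T_r(n-1)) + (\ell+1). \] For $r=3$ and $r \ge 8$, equality holds if and only if $G \in \mathcal{G}^{\ell}_{n,r}$. For $4 \le r \le 7$, if $G \in \mathcal{G}^{\ell}_{n,r}$ then equality holds, and if equality holds then either $G \in \mathcal{G}^{\ell}_{n,r}$ or $G \in \mathcal{H}^{\ell}_{n,r}$. In all cases, $\mathcal{G}^{\ell}_{n,r}$ is nonempty, and the bound is tight.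
   Context: Graphs are simple. $e(G)$ is the number of edges of $G$. $T_r(n)$ is the Turán graph: the $n$-vertex complete $r$-partite graph with parts as balanced as possible (so $T_r(n)=K_n$ if $n\le r$). $\mathcal{G}^{\ell}_{n,r}$ is the set of $n$-vertex, $K_{r+1}$-free graphs consisting of $T_r(n-1)$ plus one additional vertex of degree $\ell+1$. $\mathcal{H}^{\ell}_{n,r}$ is the set of $n$-vertex, $K_{r+1}$-free graphs consisting of $T_r((n+1+\ell)/2)$ plus an independent set of $(n-1-\ell)/2$ additional vertices, each of degree $(n-1+\ell)/2$ (this set is empty when $n\equiv\ell \pmod 2$). *)

(* Defs.v *)
From mathcomp Require Import all_boot all_order all_algebra.
Set Implicit Arguments.
Unset Strict Implicit.
Unset Printing Implicit Defensive.

Import Order.TTheory GRing.Theory Num.Theory.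
Local Open Scope ring_scope.

Record sgraph := SGraph {
  vertex :> finType;
  adj : rel vertex;
  adj_sym : symmetric adj;
  adj_irr : irreflexive adj }.

Definition edge_set (G : sgraph) : {set {set G}} :=
  [set [set p.1; p.2] | p : G * G & adj p.1 p.2].

Definition num_edges (G : sgraph) : nat := #|edge_set G|.

Definition degree (G : sgraph) (x : G) : nat := #|[set y : G | adj x y]|.

Definition degree_seq (G : sgraph) : seq nat :=
  sort leq [seq degree x | x <- enum G].

(* The paper's d_j, counted from 1: it is the j-th smallest degree when
   1 <= j <= #|G|; the other values of j are junk. *)
Definition nth_degree (G : sgraph) (j : nat) : nat :=
  nth 0%N (degree_seq G) j.-1.

Definition is_clique (G : sgraph) (A : {set G}) : Prop :=
  {in A &, forall x y, x != y -> adj x y}.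

Definition is_indep (G : sgraph) (A : {set G}) : Prop :=
  {in A &, forall x y, ~~ adj x y}.

Definition clique_free (k : nat) (G : sgraph) : Prop :=
  forall A : {set G}, #|A| = k -> ~ is_clique A.

Definition graph_iso (F G : sgraph) : Prop :=
  exists2 f : F -> G, bijective f & forall x y, adj (f x) (f y) = adj x y.

Section Induced.
Variables (G : sgraph) (A : {set G}).

Definition induced_adj : rel {x : G | x \in A} :=
  fun x y => adj (val x) (val y).

Lemma induced_adj_sym : symmetric induced_adj.
Proof. by move=> x y; apply: adj_sym. Qed.

Lemma induced_adj_irr : irreflexive induced_adj.
Proof. by move=> x; apply: adj_irr. Qed.

Definition induced : sgraph := SGraph induced_adj_sym induced_adj_irr.

End Induced.

(* The parts are the residue classes modulo r, so their sizes are n %/ r or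
   (n %/ r).+1; for n <= r this is the complete graph. *)
Section Turan.
Variables r n : nat.

Definition turan_adj : rel 'I_n := fun i j => (i %% r != j %% r)%N.

Lemma turan_adj_sym : symmetric turan_adj.
Proof. by move=> i j; rewrite /turan_adj eq_sym. Qed.

Lemma turan_adj_irr : irreflexive turan_adj.
Proof. by move=> i; rewrite /turan_adj eqxx. Qed.

Definition turan : sgraph := SGraph turan_adj_sym turan_adj_irr.

End Turan.

Definition in_Gclass (l : int) (r n : nat) (G : sgraph) : Prop :=
  [/\ #|G| = n,
      clique_free r.+1 G
    & exists v : G, (degree v)%:Z = l + 1 /\
        graph_iso (induced [set~ v]) (turan r n.-1)].

(* The halves (n+1+l)/2, (n-1-l)/2 and (n-1+l)/2 are rational numbers here, so
   no graph satisfies this when n and l have the same parity. *)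
Definition in_Hclass (l : int) (r n : nat) (G : sgraph) : Prop :=
  [/\ #|G| = n,
      clique_free r.+1 G
    & exists (S : {set G}) (m : nat),
        [/\ is_indep S,
            #|S|%:R = (n%:R - 1 - l%:~R) / 2 :> rat,
            {in S, forall v, (degree v)%:R = (n%:R - 1 + l%:~R) / 2 :> rat},
            m%:R = (n%:R + 1 + l%:~R) / 2 :> rat
          & graph_iso (induced (~: S)) (turan r m)]].

Definition low_degree (l : int) (n : nat) (G : sgraph) : Prop :=
  exists j : nat,
    [/\ (1 <= j)%N,
        j%:R <= (n%:R - 1 - l%:~R) / 2 :> rat
      & (nth_degree G j)%:Z <= j%:Z + l].

Definition edge_bound (l : int) (r n : nat) : int :=
  (num_edges (turan r n.-1))%:Z + (l + 1).

(* Meant for 3 <= r. *)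
Definition order_threshold (l : int) (r : nat) : rat :=
  let lq : rat := l%:~R in
  let rq : rat := r%:R in
  if (r == 3)%N then 6 * lq + 26
  else if (r <= 7)%N then
    Num.max (3 + lq + 4 * (lq + 2) / (rq - 3))
            (5 + lq + (rq + 2 * lq + 7) / (2 * rq - 2))
  else lq + 5 + 4 * (lq + 4) / (rq - 4).

(* Main.v *)
Require Import Defs.
From mathcomp Require Import all_boot all_order all_algebra.
From mathcomp Require Import zify lra.
Import Order.TTheory GRing.Theory Num.Theory.
Set Implicit Arguments.
Unset Strict Implicit.
Unset Printing Implicit Defensive.

(** Write t(m) for the number of edges of T_r(m) and p = l + 1, a natural
number.  The degree hypothesis provides a set S of j vertices, with
2j + p <= n, all of degree at most j + p - 1.  The edges of G either lie
outside S, where Turan's theorem leaves at most t(n - j) of them, or meet S, so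
that
<<
    e(G) <= t(n - j) + j (j + p - 1),
>>
with equality only if S is independent, its vertices all have degree
j + p - 1, and G - S is T_r(n - j) (deg_sum_low_turan).  For j = 1 the right-hand
side is the announced bound and equality describes the first extremal class.
For j >= 2 it remains to compare it with its value at j = 1, a question about
integers only.

For r >= 8 the comparison is strict already when the growth of t from n - j to
n - 1 is estimated by (1 - 1/r) m at each step from m to m + 1 (trade_lt_r8).
For 4 <= r <= 7 the rounding has to be treated more carefully: here t(m) is the
integer part of (1 - 1/r) m^2 / 2, because b (r - b) < 2r for every residue b.
The two values can agree, but only when 2j + p = n (trade_le_r47), and the
equality case then is the second extremal class.

For r = 3 the comparison succeeds unless j lies in a window of length about p/4
below its maximum (n - p)/2 (trade_lt_r3).  In that window the displayed bound
is too weak: to attain it, every vertex of S would have to be joined to nearly all of G - S,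
whereas the neighbourhood of a vertex in a K_4-free graph is triangle-free.
Let s be the largest size of a triangle-free set in the complement A of S, and
m = n - j.  Every edge of A lies in such a set N or has an end outside N, and
all degrees are at most s, so e(A) <= s^2/4 + (m - s) s; likewise at most j s
edges join A to S.  Since these edges also use up degrees in S,
<<
    e(G) <= e(A) + (e(A, S) + j (j + p - 1)) / 2
>>
(deg_sum_low_K4free).  Maximising over s leaves (2m + j)^2 / 12 +
j (j + p - 1) / 2, which for j near n/2 is about 5 n^2 / 16, less than
t(n - 1), about n^2 / 3 (K4free_edges_lt).

Turan's theorem, with uniqueness, is proved by deleting a vertex of least
degree: a K_(r+1)-free graph on N vertices has a vertex of degree at most
N - N/r, since otherwise cliques of size at most r could always be extended.
The edges are counted doubly, as sums of degrees inside vertex sets of one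
ambient graph, so that induced subgraphs appear only at the end. *)

(** * Counting edges inside vertex sets *)

Section Counting.
Variable G : sgraph.
Implicit Types (A B S : {set G}) (x y : G).

Definition deg_in A x : nat := \sum_(y in A) adj x y.

Definition deg_sum A : nat := \sum_(x in A) deg_in A x.

Lemma degreeE x : degree x = deg_in [set: G] x.
Proof.
rewrite /degree /deg_in -sum1_card big_mkcond [RHS]big_mkcond /=.
by apply: eq_bigr => y _; rewrite !inE; case: adj.
Qed.

Lemma deg_in_split A B x : B \subset A ->
  deg_in A x = deg_in B x + deg_in (A :\: B) x.
Proof. by move=> sBA; rewrite /deg_in (big_setID B) /= (setIidPr sBA). Qed.

Lemma deg_in_le A x : deg_in A x <= #|A|.
Proof. by rewrite -sum1_card; apply: leq_sum => y _; case: adj. Qed.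

Lemma deg_in_card A x : deg_in A x = #|[set y in A | adj x y]|.
Proof.
rewrite /deg_in -sum1_card big_mkcond [RHS]big_mkcond /=.
by apply: eq_bigr => y _; rewrite inE; case: (y \in A); case: adj.
Qed.

Lemma deg_sum_split A B : B \subset A ->
  deg_sum A =
  deg_sum B + deg_sum (A :\: B) + (\sum_(x in A :\: B) deg_in B x).*2.
Proof.
move=> sBA; rewrite /deg_sum (big_setID B) /= (setIidPr sBA).
have -> : \sum_(x in B) deg_in A x =
          \sum_(x in B) deg_in B x + \sum_(x in A :\: B) deg_in B x.
  rewrite (eq_bigr _ (fun x _ => deg_in_split x sBA)) big_split /=.
  congr (_ + _); rewrite /deg_in exchange_big /=.
  by apply: eq_bigr => x _; apply: eq_bigr => y _; rewrite adj_sym.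
rewrite [X in _ + X = _](eq_bigr _ (fun x _ => deg_in_split x sBA)) big_split /=.
by rewrite -addnn; lia.
Qed.

Lemma deg_in1 x : deg_in [set x] x = 0.
Proof. by rewrite /deg_in big_set1 adj_irr. Qed.

Lemma deg_in_D1 A x : x \in A -> deg_in A x = deg_in (A :\ x) x.
Proof.
by move=> Ax; rewrite /deg_in (big_setD1 x) //= adj_irr.
Qed.

Lemma deg_sum_D1 A x : x \in A ->
  deg_sum A = deg_sum (A :\ x) + (deg_in A x).*2.
Proof.
move=> Ax; rewrite (@deg_sum_split A (A :\ x)) ?subsetDl //.
rewrite setDDr setDv set0U (setIidPr _) ?sub1set //.
by rewrite /deg_sum !big_set1 deg_in1 addn0 -deg_in_D1.
Qed.

(** An edge is the image of exactly two ordered pairs of adjacent vertices. *)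
Lemma num_edges_double : (num_edges G).*2 = deg_sum [set: G].
Proof.
rewrite /deg_sum /deg_in pair_big_dep /=.
have -> : \sum_(p : G * G | (p.1 \in [set: G]) && (p.2 \in [set: G]))
            (adj p.1 p.2 : nat)
          = \sum_(p in [set p : G * G | adj p.1 p.2]) 1.
  rewrite big_mkcond [RHS]big_mkcond /=; apply: eq_bigr => p _.
  by rewrite !inE; case: adj.
rewrite (partition_big_imset (fun p : G * G => [set p.1; p.2])) /=.
have -> : [set [set p.1; p.2] | p in [set p : G * G | adj p.1 p.2]]
          = edge_set G.
  by rewrite /edge_set; apply/setP=> e; apply/imsetP/imsetP=> -[p];
    rewrite ?inE => ap ->; exists p; rewrite ?inE.
rewrite -muln2 -sum_nat_const; apply: eq_bigr => e /imsetP[[a b]] /=.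
rewrite inE /= => ab ->{e}.
have nab : a != b by apply: contraTneq ab => ->; rewrite adj_irr.
rewrite sum1_card -(_ : #|[set (a, b); (b, a)]| = 2); last first.
  by rewrite cards2 xpair_eqE (negbTE nab).
apply: eq_card => -[c d]; rewrite !inE !xpair_eqE /=.
apply/orP/andP => [[]/andP[/eqP-> /eqP->] | [+ /eqP /= E]].
- by rewrite inE /= ab eqxx.
- by rewrite inE /= adj_sym ab setUC eqxx.
rewrite inE /= => cd.
have ncd : c != d by apply: contraTneq cd => ->; rewrite adj_irr.
have: c \in [set a; b] by rewrite -E !inE eqxx.
have: d \in [set a; b] by rewrite -E !inE eqxx orbT.
rewrite !inE => /orP[]/eqP Ed /orP[]/eqP Ec; subst; rewrite ?eqxx in ncd *;
  by [|right|left].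
Qed.

End Counting.

Lemma big_setT_nat (T : finType) (F : T -> nat) :
  \sum_(x in [set: T]) F x = \sum_x F x.
Proof. by apply: eq_bigl => x; rewrite inE. Qed.

Lemma deg_sum_induced (G : sgraph) (A : {set G}) :
  deg_sum [set: induced A] = deg_sum A.
Proof.
rewrite /deg_sum /deg_in big_setT_nat [RHS]big_sub; apply: eq_bigr => x _.
by rewrite big_setT_nat [RHS]big_sub.
Qed.

Lemma num_edges_iso (F G : sgraph) : graph_iso F G -> num_edges F = num_edges G.
Proof.
case=> f bf fE; apply: double_inj; rewrite !num_edges_double /deg_sum /deg_in.
rewrite !big_setT_nat [RHS](reindex f) /=; last exact: onW_bij.
apply: eq_bigr => x _; rewrite !big_setT_nat [RHS](reindex f) /=.
  by apply: eq_bigr => y _; rewrite fE.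
exact: onW_bij.
Qed.

(** * The number of edges of the Turan graph *)

Section TuranNumber.
Variable r : nat.
Hypothesis r_gt0 : 0 < r.

Lemma divmodS n :
    [/\ (n %% r).+1 < r, n.+1 %% r = (n %% r).+1 & n.+1 %/ r = n %/ r] \/
    [/\ (n %% r).+1 = r, n.+1 %% r = 0 & n.+1 %/ r = (n %/ r).+1].
Proof.
have lt_r := ltn_pmod n r_gt0.
have En : n.+1 = n %/ r * r + (n %% r).+1 by rewrite addnS -divn_eq.
have [ltS|geS] := ltnP (n %% r).+1 r; [left|right].
  split=> //; first by rewrite {1}En modnMDl modn_small.
  by rewrite {1}En divnMDl // [X in _ + X]divn_small ?addn0.
have eqS : (n %% r).+1 = r by apply/eqP; rewrite eqn_leq lt_r.
split=> //; first by rewrite {1}En eqS modnMDl modnn.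
by rewrite {1}En eqS divnMDl // divnn r_gt0 addn1.
Qed.

Lemma sum_residue k n : k < r ->
  \sum_(i < n) (i %% r == k) = n %/ r + (k < n %% r).
Proof.
move=> kr; elim: n => [|n IHn]; first by rewrite big_ord0 div0n mod0n.
rewrite big_ord_recr /= IHn.
by have [[lt -> ->]|[eq -> ->]] := divmodS n; lia.
Qed.

(** The vertex [m] of the Turan graph on [m.+1] vertices misses the
[m %/ r] earlier vertices of its own residue class. *)
Fixpoint turan_number n :=
  if n is m.+1 then turan_number m + (m - m %/ r) else 0.

Lemma num_edges_turan n : num_edges (turan r n) = turan_number n.
Proof.
apply: double_inj; rewrite num_edges_double /deg_sum /deg_in big_setT_nat.
under eq_bigr do rewrite big_setT_nat /= /turan_adj.
have residue_neq m : \sum_(i < m) (i %% r != m %% r) = m - m %/ r.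
  have := sum_residue m (ltn_pmod m r_gt0); rewrite ltnn addn0 => <-.
  rewrite -[X in X - _]card_ord -sum1_card -sumnB => [|i _].
    by apply: eq_bigr => i _; case: eqP.
  by case: eqP.
elim: n => [|n IHn]; first by rewrite big_ord0.
rewrite big_ord_recr /= [X in _ + X = _]big_ord_recr /= eqxx addn0.
under eq_bigr do rewrite big_ord_recr /=.
rewrite big_split /= IHn doubleD -addnn -addnA; congr (_ + _).
rewrite -residue_neq -addnn; congr (_ + _).
by apply: eq_bigr => i _; rewrite eq_sym.
Qed.

Lemma turan_number_formula n :
  2 * r * turan_number n + (n %% r) * (r - n %% r) = r.-1 * n ^ 2.
Proof.
elim: n => [|n IHn]; first by rewrite mod0n mul0n addn0 !muln0.
rewrite /=; move: IHn; have := divn_eq n r; have := divmodS n.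
move: (n %/ r) (n %% r) (n.+1 %/ r) (n.+1 %% r) => q b q1 b1.
case: r r_gt0 => //= d _ [[lt -> _]|[[<-] -> _]] En IHn; last first.
  have -> : n - q = q * b + b by rewrite En; lia.
  by rewrite subSnn in IHn; move: IHn; rewrite !expnS !expn0 En; lia.
have [c Ed] : exists c, d = b + c.+1 by exists (d - b.+1); lia.
have -> : n - q = q * d + b by rewrite En; lia.
rewrite (_ : d.+1 - b = c.+2) in IHn; last by lia.
rewrite (_ : d.+1 - b.+1 = c.+1); last by lia.
by move: IHn; rewrite !expnS !expn0 En Ed; lia.
Qed.

End TuranNumber.

(** * Turan's theorem *)

Section Turan.
Variable G : sgraph.
Implicit Types (A B S : {set G}) (x y : G).

Definition clique_free_in k A :=
  forall B, B \subset A -> #|B| = k -> ~ is_clique B.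

Lemma clique_free_in_sub k A B :
  B \subset A -> clique_free_in k A -> clique_free_in k B.
Proof. by move=> sBA cfA C sCB; apply/cfA/(subset_trans sCB). Qed.

Lemma is_cliqueU1 B x : is_clique B -> {in B, forall y, adj x y} ->
  is_clique (x |: B) /\ #|x |: B| = #|B|.+1.
Proof.
move=> cB xB; split.
  move=> y z /setU1P[->|By] /setU1P[->|Bz]; rewrite ?eqxx // => nyz.
  - exact: xB.
  - by rewrite adj_sym; apply: xB.
  - exact: cB.
rewrite cardsU1 (_ : x \notin B) ?add1n //.
by apply/negP => /xB; rewrite adj_irr.
Qed.

Lemma clique_free_in_neighbours k A B x : clique_free_in k.+1 A ->
  x \in A -> B \subset A -> {in B, forall y, adj x y} -> clique_free_in k B.
Proof.
move=> cfA Ax sBA xB C sCB cC clC.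
have [|clxC cxC] := @is_cliqueU1 C x clC.
  by move=> y Cy; apply/xB/(subsetP sCB).
apply: (cfA (x |: C)) clxC; last by rewrite cxC cC.
by rewrite subUset sub1set Ax (subset_trans sCB).
Qed.

(** If every vertex missed fewer than [#|A| / r] vertices of [A], itself
included, then [r] vertices could not miss all of [A] between them, so every
clique with at most [r] vertices would extend by one more. *)
Lemma exists_small_degree r A : clique_free_in r.+1 A -> 0 < #|A| ->
  exists2 x, x \in A & #|A| <= r * (#|A| - deg_in A x).
Proof.
move=> cfA A_gt0; apply/exists_inP; apply: contraT.
rewrite negb_exists_in => /forall_inP lt_deg.
suff /(_ r.+1 (leqnn _))[B [sBA cB clB]] :
    forall k, k <= r.+1 -> exists B, [/\ B \subset A, #|B| = k & is_clique B].
  by case: (cfA B sBA cB clB).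
elim=> [|k IHk] le_kr.
  by exists set0; rewrite sub0set cards0; split=> // x y; rewrite inE.
have [B [sBA cB clB]] := IHk (ltnW le_kr).
have /exists_inP[y Ay /forall_inP yB] :
    [exists y in A, [forall x in B, adj x y]].
  apply: contraT; rewrite negb_exists_in => /forall_inP noy.
  have : #|A| <= \sum_(y in A) \sum_(x in B) ~~ adj x y.
    rewrite -sum1_card; apply: leq_sum => y Ay.
    have := noy y Ay; rewrite negb_forall_in => /exists_inP[x Bx nxy].
    by rewrite (bigD1 x) //= nxy leq_addr.
  have E x : \sum_(y in A) ~~ adj x y = #|A| - deg_in A x.
    rewrite -sum1_card /deg_in -sumnB => [|y _]; last by case: adj.
    by apply: eq_bigr => y _; case: adj.
  rewrite exchange_big /=; under eq_bigr do rewrite E.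
  move=> leA; have : r * #|A| <= \sum_(x in B) (#|A|.-1).
    apply: leq_trans (leq_mul (leqnn r) leA) _.
    rewrite big_distrr /=; apply: leq_sum => x Bx.
    by have := lt_deg x (subsetP sBA x Bx); lia.
  rewrite sum_nat_const cB; have [k0|k_gt0] := posnP k; last by nia.
  by move: leA; rewrite (cards0_eq (etrans cB k0)) big_set0; lia.
have [|cl cE] := @is_cliqueU1 B y clB.
  by move=> x Bx; rewrite adj_sym yB.
exists (y |: B); split=> //; last by rewrite cE cB.
by rewrite subUset sub1set Ay.
Qed.

Lemma deg_sum_turan r A : 0 < r -> clique_free_in r.+1 A ->
  deg_sum A <= (turan_number r #|A|).*2.
Proof.
move=> r_gt0; move: {2}#|A| (erefl #|A|) => n; elim: n A => [|n IHn] A cA cfA.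
  by rewrite (cards0_eq cA) /deg_sum big_set0.
have [|x Ax dx] := exists_small_degree cfA; first by rewrite cA.
have cAx : #|A :\ x| = n by have := cardsD1 x A; rewrite Ax cA => -[].
have := IHn _ cAx (clique_free_in_sub (subsetDl _ _) cfA).
rewrite (deg_sum_D1 Ax) cA cAx /= doubleD => leAx.
apply: leq_add => //; rewrite leq_double.
rewrite cA in dx; have := deg_in_le (A :\ x) x; rewrite -deg_in_D1 // cAx.
have := divn_eq n r; have := ltn_pmod n r_gt0; nia.
Qed.

End Turan.

(** * Uniqueness in Turan's theorem *)

(** Exchanging two residue classes of labels.  The class that receives a new
vertex in the induction for uniqueness can be any one of the smallest classes,
whereas the next label [n] has residue [n %% r]. *)
Section SwapResidues.
Variables r a b : nat.

Definition swap_nat m := if m == a then b else if m == b then a else m.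

Lemma swap_natK : involutive swap_nat.
Proof.
by move=> m; rewrite /swap_nat; do !case: eqP => //; move=> *; subst.
Qed.

Definition swap_residue i := i %/ r * r + swap_nat (i %% r).

Hypotheses (ar : a < r) (br : b < r).

Lemma swap_nat_lt m : m < r -> swap_nat m < r.
Proof. by rewrite /swap_nat; case: ifP => // _; case: ifP. Qed.

Lemma swap_residue_mod i : swap_residue i %% r = swap_nat (i %% r).
Proof.
have r_gt0 : 0 < r by apply: leq_ltn_trans ar.
by rewrite /swap_residue modnMDl modn_small // swap_nat_lt ?ltn_pmod.
Qed.

Lemma swap_residue_div i : swap_residue i %/ r = i %/ r.
Proof.
have r_gt0 : 0 < r by apply: leq_ltn_trans ar.
rewrite /swap_residue divnMDl // [X in _ + X]divn_small ?addn0 //.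
by rewrite swap_nat_lt ?ltn_pmod.
Qed.

Lemma swap_residueK : involutive swap_residue.
Proof.
move=> i; rewrite {1}/swap_residue swap_residue_div swap_residue_mod swap_natK.
by rewrite -divn_eq.
Qed.

(** Both classes have [n %/ r] elements below [n] when
[a >= b = n %% r], so the exchange preserves the interval. *)
Lemma swap_residue_lt i n : n %% r = b -> b <= a -> i < n -> swap_residue i < n.
Proof.
move=> nb ba ltin; have r_gt0 : 0 < r by apply: leq_ltn_trans ar.
have := divn_eq n r; have := divn_eq i r; rewrite nb /swap_residue.
have := ltn_pmod i r_gt0; move: (i %% r) (i %/ r) (n %/ r) => c q q' cr Ei En.
have [lt_q|ge_q] := ltnP q q'.
  have lt_c := swap_nat_lt cr; apply: (@leq_trans (q.+1 * r)); first by nia.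
  by rewrite En; nia.
have eq_q : q = q' by nia.
have lt_cb : c < b by move: ltin; rewrite Ei En eq_q; lia.
by rewrite eq_q /swap_nat; do ?case: eqP; lia.
Qed.

End SwapResidues.

Section TuranUnique.
Variable G : sgraph.
Implicit Types (A B S : {set G}) (x y : G).

(** An isomorphism from the subgraph induced on [A] to the Turan graph, with
labels in [nat] so that labellings for different [A] have the same type. *)
Definition turan_labelling r A (f : G -> nat) :=
  [/\ {in A &, injective f},
      {in A, forall x, f x < #|A|}
    & {in A &, forall x y, adj x y = (f x %% r != f y %% r)}].

Lemma turan_labelling_iso r A f : turan_labelling r A f ->
  graph_iso (induced A) (turan r #|A|).
Proof.
case=> inj_f f_lt adjE.
pose g (x : induced A) : turan r #|A| := Ordinal (f_lt (val x) (valP x)).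
exists g; last by move=> x y; rewrite /= /turan_adj -adjE ?(valP x) ?(valP y).
apply: inj_card_bij => [x y [] /inj_f E|].
  by apply: val_inj; apply: E; [apply: (valP x)|apply: (valP y)].
by rewrite card_ord card_sig.
Qed.

Lemma turan_labelling_class r A f k : turan_labelling r A f -> k < r ->
  #|[set x in A | f x %% r == k]| = #|A| %/ r + (k < #|A| %% r).
Proof.
case=> inj_f f_lt _ kr.
rewrite -sum_residue //; last exact: leq_ltn_trans kr.
(* The labels are exactly 0, ..., #|A| - 1, so classes can be counted there. *)
have mapE : perm_eq [seq f x | x <- enum A] (iota 0 #|A|).
  have uq : uniq [seq f x | x <- enum A].
    rewrite map_inj_in_uniq ?enum_uniq // => x y; rewrite !mem_enum.
    exact: inj_f.
  have sub : {subset [seq f x | x <- enum A] <= iota 0 #|A|}.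
    by move=> _ /mapP[x + ->]; rewrite mem_enum mem_iota => /f_lt.
  have sz : size (iota 0 #|A|) <= size [seq f x | x <- enum A].
    by rewrite size_map size_iota cardE.
  by apply: uniq_perm; rewrite ?iota_uniq //; case: (uniq_min_size uq sub sz).
rewrite -(big_mkord xpredT (fun i => (i %% r == k) : nat)) /index_iota subn0.
rewrite -(perm_big _ mapE) big_map big_enum /= -sum1_card.
rewrite big_mkcond [RHS]big_mkcond; apply: eq_bigr => x _.
by rewrite inE; case: (x \in A); case: eqP.
Qed.

Lemma turan_labellingU1 r A x f k : 0 < r -> x \notin A ->
  turan_labelling r A f -> k < r -> #|A| %% r <= k ->
  {in A, forall y, adj x y = (f y %% r != k)} ->
  exists g, turan_labelling r (x |: A) g.
Proof.
move=> r_gt0 xA [inj_f f_lt adjE] kr le_k adjx.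
set b := #|A| %% r; have br : b < r by rewrite ltn_mod.
pose s := swap_residue r k b.
have s_lt i : i < #|A| -> s i < #|A| by apply: swap_residue_lt.
have sK : involutive s by apply: swap_residueK.
have smod i : s i %% r = swap_nat k b (i %% r) by apply: swap_residue_mod.
have sb (m : nat) : (swap_nat k b m == b) = (m == k).
  by rewrite -(can_eq (swap_natK k b) m k) {3}/swap_nat eqxx.
have nAx y : y \in A -> y != x by apply: contraTneq => ->.
exists (fun y => if y == x then #|A| else s (f y)).
rewrite /turan_labelling cardsU1 xA add1n; split.
- move=> y z /setU1P[->|Ay] /setU1P[->|Az]; rewrite ?eqxx //.
  + by rewrite (negbTE (nAx z Az)) => E; have := s_lt _ (f_lt z Az);
      rewrite -E ltnn.
  + by rewrite (negbTE (nAx y Ay)) => E; have := s_lt _ (f_lt y Ay);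
      rewrite E ltnn.
  rewrite (negbTE (nAx y Ay)) (negbTE (nAx z Az)) => /(can_inj sK).
  exact: inj_f.
- move=> y /setU1P[->|Ay]; first by rewrite eqxx.
  by rewrite (negbTE (nAx y Ay)) ltnS ltnW ?s_lt ?f_lt.
move=> y z /setU1P[->|Ay] /setU1P[->|Az]; rewrite ?eqxx ?adj_irr //.
- by rewrite (negbTE (nAx z Az)) smod eq_sym sb adjx.
- by rewrite (negbTE (nAx y Ay)) smod sb adj_sym adjx.
rewrite (negbTE (nAx y Ay)) (negbTE (nAx z Az)) !smod.
by rewrite (can_eq (swap_natK k b)) adjE.
Qed.

(** Otherwise [x] has a neighbour in each of the [r] classes, and these
neighbours together with [x] form a clique of size [r.+1]. *)
Lemma missed_class r A x f : clique_free_in r.+1 (x |: A) ->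
  {in A &, forall y z, adj y z = (f y %% r != f z %% r)} ->
  exists2 k, k < r & {in A, forall y, f y %% r = k -> ~~ adj x y}.
Proof.
move=> cf adjE.
have [/existsP[k /forall_inP hk]|] :=
  boolP [exists k : 'I_r, forall y in A, (f y %% r == k) ==> ~~ adj x y].
  by exists k => // y Ay /eqP fy; apply: (implyP (hk y Ay)).
rewrite negb_exists => /forallP noK; exfalso.
have ex (k : 'I_r) : exists y, [/\ y \in A, f y %% r = k & adj x y].
  have := noK k; rewrite negb_forall_in => /exists_inP[y Ay].
  by rewrite negb_imply negbK => /andP[/eqP fy xy]; exists y.
have [g gP] := fin_all_exists ex.
have inj_g : injective g.
  move=> i j E; apply: val_inj => /=.
  by have [_ <- _] := gP i; have [_ <- _] := gP j; rewrite E.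
pose B := [set g k | k : 'I_r].
have [||clB cB] := @is_cliqueU1 _ B x.
- move=> _ _ /imsetP[i _ ->] /imsetP[j _ ->] nij.
  have [Ai fi _] := gP i; have [Aj fj _] := gP j.
  by rewrite adjE // fi fj; apply: contra nij => /eqP/val_inj ->.
- by move=> _ /imsetP[i _ ->]; case: (gP i).
apply: (cf (x |: B)) clB; last by rewrite cB card_imset ?card_ord.
apply: setUS; apply/subsetP => _ /imsetP[i _ ->]; by case: (gP i).
Qed.

(** Equality forces the deleted vertex [x] to miss exactly [n %/ r] vertices.
It misses a whole class, which has at least that many, so it misses precisely
one of the smallest classes and can be added to it. *)
Lemma turan_unique r A : 0 < r -> clique_free_in r.+1 A ->
  deg_sum A = (turan_number r #|A|).*2 -> exists f, turan_labelling r A f.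
Proof.
move=> r_gt0; move: {2}#|A| (erefl #|A|) => n; elim: n A => [|n IHn] A cA cfA.
  by move=> _; exists (fun _ => 0); rewrite (cards0_eq cA); split=> x; rewrite inE.
have [|x Ax dx] := exists_small_degree cfA; first by rewrite cA.
have cAx : #|A :\ x| = n by have := cardsD1 x A; rewrite Ax cA => -[].
have cfAx := clique_free_in_sub (subsetDl A [set x]) cfA.
have leAx := deg_sum_turan r_gt0 cfAx.
rewrite (deg_sum_D1 Ax) cA /= doubleD => eA.
have le_deg : deg_in A x <= n - n %/ r.
  rewrite cA in dx; have := deg_in_le (A :\ x) x; rewrite -deg_in_D1 // cAx.
  have := divn_eq n r; have := ltn_pmod n r_gt0; nia.
rewrite cAx in leAx.
have deg_x : deg_in A x = n - n %/ r by lia.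
have [|f fP] := IHn _ cAx cfAx; first by rewrite cAx; lia.
have [k kr missed] : exists2 k, k < r &
    {in A :\ x, forall y, f y %% r = k -> ~~ adj x y}.
  by apply: missed_class; [rewrite setD1K|case: fP].
pose C := [set y in A :\ x | f y %% r == k].
pose U := [set y in A :\ x | ~~ adj x y].
have sCU : C \subset U.
  by apply/subsetP => y; rewrite !inE => /andP[Ay /eqP fy]; rewrite Ay missed ?inE.
have cU : #|U| = n %/ r.
  rewrite deg_in_D1 // deg_in_card in deg_x.
  have := cardsID [set y | adj x y] (A :\ x).
  rewrite cAx (_ : _ :&: _ = [set y in A :\ x | adj x y]); last first.
    by apply/setP => y; rewrite !inE.
  rewrite deg_x (_ : _ :\: _ = U); last by apply/setP => y; rewrite !inE andbC.
  by have := leq_div n r; lia.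
have cC := turan_labelling_class fP kr; rewrite -/C cAx in cC.
have leC := subset_leq_card sCU.
have eCU : C = U by apply/eqP; rewrite eqEcard sCU cU cC leq_addr.
rewrite -(setD1K Ax); apply: (turan_labellingU1 (f := f) (k := k)) => //.
- by rewrite !inE eqxx.
- by rewrite cAx leqNgt; apply/negP => lt; move: leC; rewrite cC cU lt; lia.
move=> y Ay; have := congr1 (fun X : {set G} => y \in X) eCU.
by rewrite !(inE, Ay) /= => ->; rewrite negbK.
Qed.

End TuranUnique.

(** * Low-degree vertices *)

Section LowVertices.
Variable G : sgraph.
Implicit Types (A B N S : {set G}) (x y : G).

Lemma low_degree_set j d : j <= #|G| -> nth_degree G j <= d ->
  exists S, #|S| = j /\ {in S, forall x, degree x <= d}.
Proof.
move=> le_jG; pose lev := relpre (@degree G) leq.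
pose s := sort lev (enum G); have us : uniq s by rewrite sort_uniq enum_uniq.
have ss : size s = #|G| by rewrite size_sort -cardE.
have sseq : degree_seq G = map (@degree G) s by rewrite /degree_seq sort_map.
rewrite /nth_degree sseq => le_d; exists [set x in take j s]; split.
  by rewrite cardsE (card_uniqP _) ?take_uniq // size_takel ?ss.
move=> x; rewrite inE => xs; apply: leq_trans le_d.
have lt_i : index x (take j s) < j.
  by apply: leq_trans (geq_minl _ #|G|); rewrite -ss -size_take_min index_mem.
have lt_is : index x (take j s) < size s by rewrite ss (leq_trans lt_i).
have <- : nth x s (index x (take j s)) = x.
  by rewrite -(nth_take x lt_i) nth_index.
rewrite -(nth_map x 0 (@degree G)) //.
apply: (sorted_leq_nth leq_trans leqnn); rewrite ?inE ?size_map //.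
- by rewrite -sort_map sort_sorted //; apply: leq_total.
- by rewrite ss; lia.
by lia.
Qed.

(** Edges inside [S] are counted twice by the degrees in [S]. *)
Lemma deg_sum_low S :
  deg_sum [set: G] + deg_sum S =
  deg_sum (~: S) + (\sum_(x in S) degree x).*2.
Proof.
rewrite (deg_sum_split (subsetT (~: S))) setTD setCK.
under [X in _ = _ + X.*2]eq_bigr do
  rewrite degreeE (deg_in_split _ (subsetT (~: S))) setTD setCK.
by rewrite big_split /= -/(deg_sum S) -!addnn; lia.
Qed.

Lemma sum_degree_le S d : {in S, forall x, degree x <= d} ->
  \sum_(x in S) degree x <= #|S| * d.
Proof. by move=> leS; rewrite -sum_nat_const; apply: leq_sum => x /leS. Qed.

Lemma deg_sum0_indep S : deg_sum S = 0 -> is_indep S.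
Proof.
move=> /eqP; rewrite sum_nat_eq0 => /forall_inP h x y Sx Sy.
have := h x Sx; rewrite sum_nat_eq0 => /forall_inP/(_ y Sy).
by case: adj.
Qed.

Lemma sum_degree_eq S d : {in S, forall x, degree x <= d} ->
  \sum_(x in S) degree x = #|S| * d -> {in S, forall x, degree x = d}.
Proof.
move=> leS E x Sx; apply/eqP; move: E; rewrite -sum_nat_const => E.
have [_] := leqif_sum (fun y Sy => leqif_eq (leS y Sy)).
by rewrite E eqxx => /esym/forall_inP/(_ x Sx).
Qed.

(** Turan's theorem bounds the edges outside [S], the degrees in [S] bound the
other ones; the loss is [deg_sum S], which vanishes only for independent
[S]. *)
Lemma deg_sum_low_turan r S d : 0 < r -> clique_free r.+1 G ->
    {in S, forall x, degree x <= d} ->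
  deg_sum [set: G] <= (turan_number r (#|G| - #|S|) + #|S| * d).*2
  /\ (deg_sum [set: G] = (turan_number r (#|G| - #|S|) + #|S| * d).*2 ->
      [/\ is_indep S, {in S, forall x, degree x = d}
        & graph_iso (induced (~: S)) (turan r (#|G| - #|S|))]).
Proof.
move=> r_gt0 cf leS.
have cfA : clique_free_in r.+1 (~: S) by move=> B _; apply: cf.
have cA : #|~: S| = #|G| - #|S| by have := cardsC S; lia.
have := deg_sum_low S; have := sum_degree_le leS; have := deg_sum_turan r_gt0 cfA.
rewrite cA => leA leD eq; split=> [|eqG]; first by lia.
have [S0 A0 D0] : [/\ deg_sum S = 0,
    deg_sum (~: S) = (turan_number r (#|G| - #|S|)).*2
    & \sum_(x in S) degree x = #|S| * d] by split; lia.
split; [exact: deg_sum0_indep | exact: sum_degree_eq |].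
have [|f fP] := turan_unique r_gt0 cfA; first by rewrite cA.
by rewrite -cA; apply: turan_labelling_iso fP.
Qed.

(** * Graphs without K_4 *)

(** The boolean form allows a finite search for a largest clique-free set. *)
Definition is_cliqueb B := [forall x in B, forall y in B, (x != y) ==> adj x y].

Lemma is_cliqueP B : reflect (is_clique B) (is_cliqueb B).
Proof.
apply: (iffP forall_inP) => [h x y Bx By nxy|h x Bx].
  by have /forall_inP/(_ y By)/implyP-> := h x Bx.
by apply/forall_inP => y By; apply/implyP; apply: h.
Qed.

Lemma exists_max_clique_free k A : exists N : {set G}, [/\ N \subset A,
  clique_free_in k.+1 N &
  forall B, B \subset A -> clique_free_in k.+1 B -> #|B| <= #|N|].
Proof.
pose cfb B := [forall C : {set G},
  (C \subset B) && (#|C| == k.+1) ==> ~~ is_cliqueb C].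
have cfP B : reflect (clique_free_in k.+1 B) (cfb B).
  apply: (iffP forallP) => h C; first move=> sCB cC clC.
    by have := h C; rewrite sCB cC eqxx /= => /is_cliqueP.
  by apply/implyP => /andP[sCB /eqP cC]; apply/is_cliqueP/h.
have P0 : (set0 \subset A) && cfb set0.
  by rewrite sub0set; apply/cfP => C; rewrite subset0 => /eqP->; rewrite cards0.
case: (@arg_maxnP _ set0 (fun B => (B \subset A) && cfb B) (fun B => #|B|) P0)
  => N /andP[sNA /cfP cfN] maxN.
by exists N; split=> // B sBA cfB; apply: maxN; rewrite sBA; apply/cfP.
Qed.

(** Every edge of [A] lies in [N] or has an end in [A :\: N], and degrees are
at most [#|N|] because neighbourhoods have no clique of size [k.+1]. *)
Lemma deg_sum_max_clique_free k A N : clique_free_in k.+2 A ->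
    N \subset A ->
    (forall B, B \subset A -> clique_free_in k.+1 B -> #|B| <= #|N|) ->
  deg_sum A <= deg_sum N + ((#|A| - #|N|) * #|N|).*2.
Proof.
move=> cfA sNA maxN.
have le_deg x : x \in A -> deg_in A x <= #|N|.
  move=> Ax; rewrite deg_in_card; apply: maxN.
    by apply/subsetP => y; rewrite inE => /andP[].
  apply: (clique_free_in_neighbours cfA Ax).
    by apply/subsetP => y; rewrite inE => /andP[].
  by move=> y; rewrite inE => /andP[].
rewrite (deg_sum_split sNA).
have -> : #|A| - #|N| = #|A :\: N| by rewrite cardsD (setIidPr sNA).
have : \sum_(x in A :\: N) deg_in A x <= #|A :\: N| * #|N|.
  by rewrite -sum_nat_const; apply: leq_sum => x /setDP[Ax _]; apply: le_deg.
under eq_bigr do rewrite (deg_in_split _ sNA).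
rewrite big_split /= -/(deg_sum _); lia.
Qed.

(** Here [s] is the largest size of a triangle-free set outside [S], and [X] is
the number of edges between [S] and its complement.  The last inequality
combines [2 e(S) + X <= #|S| * d] with Mantel's bound on a triangle-free set of
size [s]. *)
Lemma deg_sum_low_K4free S d : clique_free 4 G ->
    {in S, forall x, degree x <= d} ->
  exists s X, [/\ s <= #|G| - #|S|, X <= #|S| * s, X <= #|S| * d &
    2 * deg_sum [set: G] <= s * s + 4 * (#|G| - #|S| - s) * s
                            + 2 * X + 2 * (#|S| * d)].
Proof.
move=> cf leS; pose A := ~: S.
have cfA B : clique_free_in 4 B by move=> C _; apply: cf.
have cA : #|A| = #|G| - #|S| by rewrite /A; have := cardsC S; lia.
have [N [sNA cfN maxN]] := exists_max_clique_free 2 A.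
have lX : \sum_(x in S) deg_in A x <= #|S| * #|N|.
  rewrite -sum_nat_const; apply: leq_sum => x Sx.
  rewrite deg_in_card; apply: maxN.
    by apply/subsetP => y; rewrite inE => /andP[].
  apply: (clique_free_in_neighbours (cfA setT) (in_setT x) (subsetT _)).
  by move=> y; rewrite inE => /andP[].
exists #|N|, (\sum_(x in S) deg_in A x).
have lN := subset_leq_card sNA; have lA := deg_sum_max_clique_free (cfA A) sNA maxN.
have l2 := deg_sum_turan (isT : 0 < 2) cfN.
have f2 := turan_number_formula (isT : 0 < 2) #|N|.
have := deg_sum_split (subsetT A); rewrite setTD setCK => eqG.
have := deg_sum_low S; have := sum_degree_le leS; rewrite -/A => lD eqD.
rewrite cA in lN lA; split=> //; first by lia.
have {}f2 : 4 * turan_number 2 #|N| <= #|N| * #|N|.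
  by rewrite mulnn -[X in _ <= X]mul1n -f2 leq_addr.
rewrite -!mulnA; move: lA; set q := (_ - _ - _) * _; lia.
Qed.

End LowVertices.

(** * Trading low-degree vertices for a single one: arithmetic *)

Section Numeric.
Variable r : nat.
Hypothesis r_gt0 : 0 < r.
Local Notation t := (turan_number r).

Lemma turan_number_le n : 2 * r * t n <= r.-1 * (n * n).
Proof. by rewrite mulnn -(turan_number_formula r_gt0) leq_addr. Qed.

(** The rounding error [b * (r - b)], with [b] the residue of [n], is at most
[r ^ 2 / 4], which is less than [2 * r] for [r < 8]. *)
Lemma turan_number_gt n : r <= 7 -> r.-1 * (n * n) < 2 * r * t n + 2 * r.
Proof.
move=> r_le7; rewrite mulnn -(turan_number_formula r_gt0) ltn_add2l.
have := ltn_pmod n r_gt0; move: (n %% r) => b.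
case: r r_gt0 r_le7 => [|[|[|[|[|[|[|[|?]]]]]]]] // _ _;
  by case: b => [|[|[|[|[|[|[|?]]]]]]].
Qed.

(** Passing from [m] to [m.+1] vertices adds [m - m %/ r] edges, which is at
least [(1 - 1/r) * m]; the terms with [k] sum these lower bounds. *)
Lemma turan_number_growth m k :
  2 * r * t m + r.-1 * (2 * k * m + k * k) <= 2 * r * t (m + k) + r.-1 * k.
Proof.
elim: k => [|k IHk]; first by rewrite addn0 !muln0 addn0.
rewrite addnS /=.
have : r.-1 * (m + k) <= r * (m + k - (m + k) %/ r).
  clear IHk; move: (m + k) => N.
  have := divn_eq N r; have := ltn_pmod N r_gt0.
  move: (N %/ r) (N %% r) => q b.
  case: r r_gt0 => //= d _ lt ->.
  by rewrite (_ : _ - q = q * d + b) ?mulnDr ?mulSn; lia.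
move: IHk; set x := _ - _; lia.
Qed.

End Numeric.

(** The hypothesis on the order, with [p = l + 1] and denominators cleared. *)
Definition large_order p r n :=
  [\/ r = 3 /\ 6 * p + 20 <= n,
      4 <= r <= 7 /\
        ((p + 2) * (r - 3) + 4 * (p + 1) <= n * (r - 3) /\
         (2 * r - 2) * (p + 4) + r + 2 * p + 5 <= n * (2 * r - 2)),
      8 <= r /\ (p + 4) * (r - 4) + 4 * (p + 3) <= n * (r - 4)
    | [/\ p = 2, r = 8 & n = 10]].

Lemma trade_lt_r8 p r n j : 8 <= r -> large_order p r n ->
    2 <= j -> 2 * j + p <= n ->
  turan_number r (n - j) + j * (j + p - 1) < turan_number r n.-1 + p.
Proof.
move=> r8 lo j2 jn.
have lo' : (p + 4) * (r - 4) + 4 * (p + 3) <= n * (r - 4) \/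
           [/\ p = 2, r = 8 & n = 10].
  by case: lo => [[? _]|[? _]|[_ ?]|?]; [lia|lia|left|right].
have [k Ej] : exists k, j = k.+1 by exists j.-1; lia.
have [u En] : exists u, n = 2 * k + 2 + p + u by exists (n - 2 * j - p); lia.
have [q Er] : exists q, r = q + 8 by exists (r - 8); lia.
have := @turan_number_growth r ltac:(lia) (n - j) k.
have -> : n - j + k = n.-1 by lia.
have -> : n - j = k + 1 + p + u by lia.
move: (turan_number _ _) (turan_number _ _) => t1 t0 H.
subst j n r; rewrite (_ : (q + 8).-1 = q + 7) in H; last by lia.
(* The estimated gain, divided by k, is positive. *)
have key : 2 * (q + 8) * (k + p + 1) + (q + 7) < (q + 7) * (2 * (k + 1 + p + u) + k).
  clear H; case: lo' => [L|[Ep Eq En]]; last first.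
    have q0 : q = 0 by lia.
    by subst p q; lia.
  rewrite (_ : q + 8 - 4 = q + 4) in L; last by lia.
  have {}L : 4 * p + 12 + 2 * (q + 4) <= (2 * k + u) * (q + 4) by lia.
  have : (q + 4) * 1 <= (q + 4) * k by rewrite leq_mul //; lia.
  lia.
have keyk := leq_mul (leqnn k) key.
rewrite -(@ltn_pmul2l (2 * (q + 8))) ?muln_gt0 ?addn_gt0 ?orbT //.
rewrite (_ : k.+1 + p - 1 = k + p); last by lia.
clear - H keyk j2; lia.
Qed.

(** Up to a rounding error less than [2 * r], the gain from trading [j = k.+1]
low vertices for one, multiplied by [2 * r], is
[r.-1 * (2 * m + k) * k - 2 * r * (k + p + 1) * k].  The gain is an integer, so
it is nonnegative if this estimate is, and positive if the estimate is at least
[2 * r]. *)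
Lemma turan_number_compare r m k p : 0 < r <= 7 ->
  2 * r * (k + p + 1) <= r.-1 * (2 * m + k) ->
  turan_number r m + k.+1 * (k + p) <= turan_number r (m + k) + p /\
  (2 * r + 2 * r * (k + p + 1) * k <= r.-1 * (2 * m + k) * k ->
   turan_number r m + k.+1 * (k + p) < turan_number r (m + k) + p).
Proof.
case/andP=> r_gt0 r_le7 key; have keyk := leq_mul key (leqnn k).
have up := turan_number_le r_gt0 m; have lo := turan_number_gt r_gt0 (m + k) r_le7.
move: up lo keyk; move: (turan_number _ _) (turan_number _ _) => t1 t0.
case: r r_gt0 {r_le7 key} => //= d _ up lo keyk; split=> [|gap].
  by rewrite -ltnS -(@ltn_pmul2l (2 * d.+1)) // !mulnS; lia.
by rewrite -(@ltn_pmul2l (2 * d.+1)) //; lia.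
Qed.

Lemma trade_le_r47 p r n j : 4 <= r <= 7 -> large_order p r n ->
    2 <= j -> 2 * j + p <= n ->
  turan_number r (n - j) + j * (j + p - 1) <= turan_number r n.-1 + p /\
  (2 * j + p < n ->
   turan_number r (n - j) + j * (j + p - 1) < turan_number r n.-1 + p).
Proof.
move=> r47 lo j2 jn.
have [lo1 lo2] : (p + 2) * (r - 3) + 4 * (p + 1) <= n * (r - 3) /\
         (2 * r - 2) * (p + 4) + r + 2 * p + 5 <= n * (2 * r - 2).
  by case: lo => [[? _]|[_ ?]|[? _]|[_ ? _]]; [lia| |lia|lia].
have [k Ej] : exists k, j = k.+1 by exists j.-1; lia.
have [u En] : exists u, n = 2 * k + 2 + p + u by exists (n - 2 * j - p); lia.
have [q Er] : exists q, r = q + 4 by exists (r - 4); lia.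
have -> : n.-1 = n - j + k by lia.
have -> : j + p - 1 = k + p by lia.
have -> : n - j = k + 1 + p + u by lia.
have [||le lt] := @turan_number_compare r (k + 1 + p + u) k p; first by lia.
  rewrite Er (_ : (q + 4).-1 = q + 3); last by lia.
  move: lo1; rewrite Er En (_ : q + 4 - 3 = q + 1); last by lia.
  clear; lia.
(* As u >= 1, the first lower bound on n makes the gain at least r k, enough
   for k >= 2; the second one is exactly what k = 1 needs. *)
rewrite Ej; split=> // ju; apply: lt; have u_gt0 : 0 < u by lia.
have [k1|k2] : k = 1 \/ 2 <= k by lia.
  move: lo2; rewrite k1 Er En k1 (_ : (q + 4).-1 = q + 3); last by lia.
  rewrite (_ : 2 * (q + 4) - 2 = 2 * q + 6); last by lia.
  clear; lia.
have gap : r + 2 * r * (k + p + 1) <= r.-1 * (2 * (k + 1 + p + u) + k).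
  rewrite Er (_ : (q + 4).-1 = q + 3); last by lia.
  move: lo1; rewrite Er En (_ : q + 4 - 3 = q + 1); last by lia.
  have : (3 * q + 9) * 1 <= (3 * q + 9) * u by rewrite leq_mul.
  clear; lia.
have := leq_mul gap (leqnn k).
have : r * 2 <= r * k by rewrite leq_mul.
clear; lia.
Qed.

Lemma turan_number3_ge n : (n * n).-1 <= 3 * turan_number 3 n.
Proof.
have := turan_number_formula (isT : 0 < 3) n.
have := ltn_pmod n (isT : 0 < 3); move: (n %% 3) => b.
by case: b => [|[|[|?]]] //= _; rewrite -mulnn; lia.
Qed.

Lemma trade_lt_r3 p n j : 6 * p + 20 <= n -> 2 <= j ->
    4 * j + 3 * p + 2 <= 2 * n ->
  turan_number 3 (n - j) + j * (j + p - 1) < turan_number 3 n.-1 + p.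
Proof.
move=> lo j2 jn.
have [k Ej] : exists k, j = k.+1 by exists j.-1; lia.
have [m En] : exists m, n = m + k + 1 by exists (n - j); lia.
have -> : n.-1 = m + k by lia.
have -> : j + p - 1 = k + p by lia.
have -> : n - j = m by lia.
have key : 6 * (k + p + 1) + 2 <= 2 * (2 * m + k) by lia.
have gap : 6 + 6 * (k + p + 1) * k <= 2 * (2 * m + k) * k.
  have [k3|k2] : 3 <= k \/ k = 1 \/ k = 2 by lia.
    by have := leq_mul key (leqnn k); lia.
  by case: k2 => k_eq; rewrite k_eq in key *; lia.
by rewrite Ej; apply: (turan_number_compare _ _).2 => //; lia.
Qed.

(** Maximising the bound of [deg_sum_low_K4free] over [s] gives
[(2 * n - j) ^ 2 / 12 + j * (j + p - 1) / 2].  At [2 * j = n - p] this is below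
the target by about [n * (n - 6 * p - 20) / 48]: whence the bound on [n]. *)
Lemma K4free_edges_lt p n j s X E : 6 * p + 20 <= n -> 2 * j + p <= n ->
    2 * n < 4 * j + 3 * p + 2 ->
    s <= n - j -> X <= j * s -> X <= j * (j + p - 1) ->
    2 * E <= s * s + 4 * (n - j - s) * s + 2 * X + 2 * (j * (j + p - 1)) ->
  E < (turan_number 3 n.-1 + p).*2.
Proof.
move=> lo jn near les X1 X2 leE.
have [k Ej] : exists k, j = k.+1 by exists j.-1; lia.
have [u En] : exists u, n = 2 * k + 2 + p + u by exists (n - 2 * j - p); lia.
have u_le : 2 * u <= p + 1 by lia.
have En1 : n.-1 = 2 * k + 1 + p + u by lia.
have lt := turan_number3_ge n.-1; rewrite En1 in lt *.
have [v Ev] : exists v, n - j = s + v by exists (n - j - s); lia.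
have Evs : s + v = k + 1 + p + u by lia.
rewrite Ev addKn Ej (_ : k.+1 + p - 1 = k + p) in leE X1 X2; last by lia.
(* The estimate below is sharp for p = 0, n = 20, j = 10 at s = 10, where the
   number X of crossing edges is limited by the degrees in S rather than s. *)
have [[p0 [u0 k9]]|loose] :
    (p = 0 /\ u = 0 /\ k = 9) \/ 0 < p \/ 0 < u \/ 6 * p + 20 < n by lia.
  subst p u k; have {Ev Evs} v_eq : v = 10 - s by lia.
  subst v; have s_le : s <= 10 by lia.
  move: s_le X1 leE; clear - X2 lt.
  by case: s => [|[|[|[|[|[|[|[|[|[|[|?]]]]]]]]]]] //; lia.
(* 3 s^2 + 12 v s + 6 j s = (2m + j)^2 - (s - 2v - j)^2, where m = s + v. *)
have amgm : 3 * (s * s) + 12 * (v * s) + 6 * (k.+1 * s)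
            <= (3 * k + 3 + 2 * p + 2 * u) * (3 * k + 3 + 2 * p + 2 * u).
  have -> : 3 * k + 3 + 2 * p + 2 * u = 2 * s + 2 * v + k.+1 by lia.
  by have [+ _] := nat_Cauchy s (2 * v + k.+1); rewrite -!mulnn; lia.
suff gap : 4 * ((3 * k + 3 + 2 * p + 2 * u) * (3 * k + 3 + 2 * p + 2 * u))
       + 24 * (k.+1 * (k + p)) + 16
     < 16 * ((2 * k + 1 + p + u) * (2 * k + 1 + p + u)) + 48 * p by lia.
have lo_n := leq_mul (leqnn n) lo; have lo_u := leq_mul (leqnn u) lo.
have u_u := leq_mul (leqnn u) u_le.
have slack : 2 * (p * u) + 7 * (u * u) + 12 * u + n * (6 * p + 20)
           < n * n + 6 * (u * n) + 5 * (p * p) + 36 * p.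
  case: loose => [p_gt0|[u_gt0|lt_n]]; [lia|lia|].
  by have := leq_mul (leqnn n) lt_n; lia.
by move: slack; rewrite En; lia.
Qed.

(** * The extremal configurations *)

(** For [j = 1] the general estimate is the bound itself; for [j >= 2] the trade
shows that it is smaller, or equal in the exceptional case. *)
Lemma num_edges_low p r n (G : sgraph) j (S : {set G}) : #|G| = n ->
    large_order p r n -> clique_free r.+1 G -> #|S| = j ->
    {in S, forall x, degree x <= j + p - 1} -> 1 <= j -> 2 * j + p <= n ->
  num_edges G <= turan_number r n.-1 + p /\
  (num_edges G = turan_number r n.-1 + p ->
   (j = 1 \/ 4 <= r <= 7 /\ 2 * j + p = n) /\
   [/\ is_indep S, {in S, forall x, degree x = j + p - 1}
     & graph_iso (induced (~: S)) (turan r (n - j))]).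
Proof.
move=> cG lo cf cS leS j_gt0 jn.
have r_gt0 : 0 < r by case: lo => [[-> _]|[]|[]|[_ -> _]]; lia.
have [le eq] := deg_sum_low_turan r_gt0 cf leS.
have eE := num_edges_double G.
rewrite cG cS in le eq; rewrite -eE leq_double in le.
have {}eq : num_edges G = turan_number r (n - j) + j * (j + p - 1) ->
    [/\ is_indep S, {in S, forall x, degree x = j + p - 1}
     & graph_iso (induced (~: S)) (turan r (n - j))].
  by move=> E; apply: eq; rewrite -eE E.
have [j1|j2] : j = 1 \/ 2 <= j by lia.
  have E1 : turan_number r (n - j) + j * (j + p - 1) = turan_number r n.-1 + p.
    by rewrite j1 mul1n addKn subn1.
  by rewrite -E1; split=> // E; split; [left | apply: eq].
have [r3|[r47|r8]] : r = 3 \/ 4 <= r <= 7 \/ 8 <= r.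
  by case: lo => [[-> _]|[? _]|[? _]|[_ -> _]]; lia.
- have lt : num_edges G < turan_number r n.-1 + p.
    have lo3 : 6 * p + 20 <= n.
      by case: lo => [[_ ?]|[? _]|[? _]|[_ ? _]]; [|lia|lia|lia].
    rewrite r3 in le cf *; have [far|near] := leqP (4 * j + 3 * p + 2) (2 * n).
      exact: leq_ltn_trans le (trade_lt_r3 lo3 j2 far).
    have [s [X [les X1 X2 leE]]] := deg_sum_low_K4free cf leS.
    rewrite cG cS in les X1 X2 leE; rewrite -ltn_double eE.
    exact: (K4free_edges_lt lo3 jn near les X1 X2).
  by split; [apply: ltnW | move=> E; move: lt; rewrite E ltnn].
- have [le' lt'] := trade_le_r47 r47 lo j2 jn.
  split=> [|E]; first exact: leq_trans le le'.
  have [ltn|gen] := ltnP (2 * j + p) n.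
    by move: (lt' ltn) le le'; rewrite E; lia.
  by split; [right; lia | apply: eq; lia].
have lt := leq_ltn_trans le (trade_lt_r8 r8 lo j2 jn).
by split; [apply: ltnW | move=> E; move: lt; rewrite E ltnn].
Qed.

(** What the first extremal class requires: [j = 1] is admissible, and [p]
neighbours of the additional vertex can be chosen outside a smallest class. *)
Lemma large_order_room p r n : large_order p r n ->
  p + 2 <= n /\ p <= n.-1 - n.-1 %/ r.
Proof.
move=> lo; have [r3 pn] : 3 <= r /\ (p + 2 <= n /\ r * p <= (n - 1) * (r - 1)).
  case: lo => [[-> ?]|[r47 [lo1 lo2]]|[r8 lo]|[-> -> ->]]; [lia| | |lia].
    have [E|[E|[E|E]]] : r = 4 \/ r = 5 \/ r = 6 \/ r = 7 by lia.
    - by rewrite E in lo1 lo2 *; lia.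
    - by rewrite E in lo1 lo2 *; lia.
    - by rewrite E in lo1 lo2 *; lia.
    by rewrite E in lo1 lo2 *; lia.
  have [q Er] : exists q, r = q + 8 by exists (r - 8); lia.
  have lt : p + 4 < n.
    rewrite -(@ltn_pmul2r (r - 4)); lia.
  have [m En] : exists m, n = p + 4 + m by exists (n - p - 4); lia.
  split; first by lia. split; first by lia.
  have Er4 : r - 4 = q + 4 by lia.
  have Er1 : r - 1 = q + 7 by lia.
  have En1 : n - 1 = p + 3 + m by lia.
  by move: lo; rewrite Er1 En1 Er4 Er En; clear; lia.
split; first by case: pn.
have r_gt0 : 0 < r by lia.
case: pn => n2; rewrite !subn1; move: n.-1 => N.
have := divn_eq N r; have := ltn_pmod N r_gt0.
move: (N %/ r) (N %% r) => a b; case: r r_gt0 {lo r3} => //= d _ ltb -> le.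
rewrite (_ : _ - a = a * d + b); last by lia.
rewrite -ltnS -(@ltn_pmul2l d.+1) //; apply: leq_ltn_trans le _; lia.
Qed.

(** The Turan graph with one additional vertex [None], joined to [D]. *)
Section ExtremalGraph.
Variables (r N : nat) (D : {set 'I_N}).

Definition turan_plus_adj : rel (option 'I_N) := fun x y =>
  match x, y with
  | Some i, Some j => i %% r != j %% r
  | None, Some i | Some i, None => i \in D
  | None, None => false
  end.

Lemma turan_plus_adj_sym : symmetric turan_plus_adj.
Proof. by case=> [i|] [j|] //=; rewrite eq_sym. Qed.

Lemma turan_plus_adj_irr : irreflexive turan_plus_adj.
Proof. by case=> [i|] //=; rewrite eqxx. Qed.

Definition turan_plus : sgraph := SGraph turan_plus_adj_sym turan_plus_adj_irr.

(** Giving [None] the colour [r.-1] extends the colouring by residues to a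
proper colouring with [r] colours. *)
Lemma turan_plus_clique_free : 0 < r -> {in D, forall i : 'I_N, i %% r != r.-1} ->
  clique_free r.+1 turan_plus.
Proof.
move=> r_gt0 Dr C cC clC.
pose c (x : turan_plus) := if x is Some i then i %% r else r.-1.
have c_lt x : c x < r by case: x => [i|] /=; rewrite ?ltn_pmod ?ltn_predL.
have cN (x y : turan_plus) : adj x y -> c x != c y.
  by case: x y => [i|] [j|] //= /Dr; rewrite // eq_sym.
have inj : {in C &, injective (fun x => Ordinal (c_lt x))}.
  move=> x y Cx Cy [E]; apply/eqP; apply: contraT => /(clC x y Cx Cy)/cN.
  by rewrite E eqxx.
have := leq_card_in (fun x => Ordinal (c_lt x)) C inj.
by rewrite cC card_ord ltnn.
Qed.

Lemma turan_plus_degree : @degree turan_plus None = #|D|.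
Proof.
rewrite /degree -(card_imset (mem D) (@Some_inj _)) /=.
apply: eq_card => -[i|]; rewrite inE /=.
  by rewrite mem_imset //; apply: Some_inj.
by apply/esym/imsetP => -[].
Qed.

Lemma turan_plus_induced :
  graph_iso (induced [set~ (None : turan_plus)]) (turan r N).
Proof.
have cN : #|[set~ (None : turan_plus)]| = N by rewrite cardsC1 card_option card_ord.
rewrite -{2}cN; apply: (@turan_labelling_iso turan_plus r _ (oapp val 0)).
split=> [[i|] [j|]|[i|]|[i|] [j|]]; rewrite ?inE //= ?cN //.
by move=> _ _ /val_inj->.
Qed.

End ExtremalGraph.

Lemma exists_extremal r n p : 0 < r -> 0 < n -> p <= n.-1 - n.-1 %/ r ->
  exists G : sgraph, [/\ #|G| = n, clique_free r.+1 G & exists v : G,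
    degree v = p /\ graph_iso (induced [set~ v]) (turan r n.-1)].
Proof.
move=> r_gt0 n_gt0 le_p.
pose A := [set i : 'I_n.-1 | i %% r != r.-1].
have cA : p <= #|A|.
  apply: leq_trans le_p _; rewrite leq_subLR.
  have := @sum_residue r r_gt0 r.-1 n.-1; rewrite ltn_predL => /(_ r_gt0).
  have -> : (r.-1 < n.-1 %% r) = false by have := ltn_pmod n.-1 r_gt0; lia.
  rewrite addn0 => <-; rewrite -[X in X <= _]card_ord -!sum1_card big_mkcond /=.
  rewrite [X in _ <= _ + X]big_mkcond -big_split /=.
  by apply: leq_sum => i _; rewrite inE; case: eqP.
have [D [sDA cD]] : exists D : {set 'I_n.-1}, D \subset A /\ #|D| = p.
  have le_s : p <= size (enum A) by rewrite -cardE.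
  exists [set i in take p (enum A)]; split.
    by apply/subsetP => i; rewrite inE => /mem_take; rewrite mem_enum.
  by rewrite cardsE (card_uniqP _) ?take_uniq ?enum_uniq // size_takel.
exists (turan_plus r D); split.
- by rewrite card_option card_ord prednK.
- by apply: turan_plus_clique_free => // i /(subsetP sDA); rewrite inE.
by exists None; rewrite turan_plus_degree cD; split=> //; apply: turan_plus_induced.
Qed.

Lemma num_edges_add_vertex r (G : sgraph) (v : G) N : 0 < r ->
  graph_iso (induced [set~ v]) (turan r N) ->
  num_edges G = turan_number r N + degree v.
Proof.
move=> r_gt0 /num_edges_iso; rewrite num_edges_turan // => E.
apply: double_inj; rewrite num_edges_double (deg_sum_D1 (in_setT v)) -degreeE.
by rewrite doubleD -E num_edges_double deg_sum_induced setTD.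
Qed.

Lemma nth_degree1_le (G : sgraph) (v : G) : nth_degree G 1 <= degree v.
Proof.
rewrite /nth_degree /=.
have v_in : degree v \in degree_seq G.
  by rewrite mem_sort map_f // mem_enum.
rewrite -[X in _ <= X](nth_index 0 v_in).
apply: (sorted_leq_nth leq_trans leqnn); rewrite ?inE ?index_mem //.
  by rewrite sort_sorted //; apply: leq_total.
by case: (degree_seq G) v_in.
Qed.

Local Open Scope ring_scope.

Lemma order_threshold_large (l : int) (r n : nat) : -1 <= l -> (3 <= r)%N ->
    (order_threshold l r <= n%:R \/ [/\ l = 1, r = 8%N & n = 10%N]) ->
  exists p : nat, l = p%:Z - 1 /\ large_order p r n.
Proof.
move=> l1 r3 hn.
have [p El] : exists p : nat, l = p%:Z - 1 by exists (absz (l + 1)); lia.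
exists p; split=> //; case: hn => [hn|[l2 -> ->]]; last first.
  by apply: Or44; split=> //; lia.
move: hn; rewrite /order_threshold.
have -> : l%:~R = p%:R - 1 :> rat by rewrite El intrD.
have [r_eq|r_neq] := eqVneq r 3%N.
  move=> hn; apply: Or41; split=> //.
  by rewrite -(ler_nat rat) natrD natrM; lra.
have [r7|r8] := leqP r 7; last first.
  move=> hn; apply: Or43; split=> //.
  have r4 : 0 < r%:R - 4 :> rat by rewrite subr_gt0 ltr_nat; lia.
  rewrite -(ler_nat rat) natrD !natrM !natrD natrB; last by lia.
  move: hn; rewrite -lerBrDl ler_pdivrMr //; nra.
rewrite ge_max => /andP[h1 h2]; apply: Or42; split; first by lia.
have r3' : 0 < r%:R - 3 :> rat by rewrite subr_gt0 ltr_nat; lia.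
have r2' : 0 < 2 * r%:R - 2 :> rat by rewrite subr_gt0 -natrM ltr_nat; lia.
split.
  rewrite -(ler_nat rat) natrD !natrM !natrD natrB; last by lia.
  by move: h1; rewrite -lerBrDl ler_pdivrMr //; nra.
rewrite -(ler_nat rat) !natrD !natrM natrB ?natrM ?natrD; last by lia.
by move: h2; rewrite -lerBrDl ler_pdivrMr //; nra.
Qed.

Theorem theorem4p1 (l : int) (r n : nat) (hl : -1 <= l) (hr : (3 <= r)%N)
    (hn : order_threshold l r <= n%:R \/ [/\ l = 1, r = 8%N & n = 10%N]) :
  [/\ forall G : sgraph, #|G| = n -> clique_free r.+1 G -> low_degree l n G ->
        [/\ (num_edges G)%:Z <= edge_bound l r n,
            r = 3%N \/ (8 <= r)%N ->
              ((num_edges G)%:Z = edge_bound l r n <-> in_Gclass l r n G)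
          & (4 <= r <= 7)%N ->
              (in_Gclass l r n G -> (num_edges G)%:Z = edge_bound l r n) /\
              ((num_edges G)%:Z = edge_bound l r n ->
                 in_Gclass l r n G \/ in_Hclass l r n G)],
      exists G : sgraph, in_Gclass l r n G
    & exists G : sgraph,
        [/\ #|G| = n, clique_free r.+1 G, low_degree l n G
          & (num_edges G)%:Z = edge_bound l r n]].
Proof.
have [p [El lo]] := order_threshold_large hl hr hn.
have r_gt0 : (0 < r)%N by apply: leq_trans hr.
have [pn room] := large_order_room lo.
have lQ : l%:~R = p%:R - 1 :> rat by rewrite El intrD.
have boundE : edge_bound l r n = (turan_number r n.-1 + p)%N%:Z.
  by rewrite /edge_bound num_edges_turan // El; lia.
have G_edges (G : sgraph) : in_Gclass l r n G -> (num_edges G)%:Z = edge_bound l r n.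
  case=> _ _ [v [dv iso]]; rewrite boundE (num_edges_add_vertex r_gt0 iso).
  by move: dv; rewrite El; lia.
have G_low (G : sgraph) : in_Gclass l r n G -> low_degree l n G.
  case=> _ _ [v [dv _]]; exists 1%N; split=> //.
    have : (p + 2)%:R <= n%:R :> rat by rewrite ler_nat.
    by rewrite lQ natrD; lra.
  by have := nth_degree1_le v; move: dv; lia.
have [G0 G0P] : exists G : sgraph, in_Gclass l r n G.
  have n_gt0 : (0 < n)%N by lia.
  have [G [cG cf [v [dv iso]]]] := exists_extremal r_gt0 n_gt0 room.
  by exists G; split=> //; exists v; split=> //; rewrite dv El; lia.
split; [|by exists G0|]; last first.
  by exists G0; case: (G0P) => cG cf _; split; [|by []|apply: G_low|apply: G_edges].
move=> G cG cf [j [j_gt0 j_le d_le]].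
have {j_le} jn : (2 * j + p <= n)%N.
  by rewrite -(ler_nat rat) natrD natrM; move: j_le; rewrite lQ; lra.
have [||S [cS leS]] := @low_degree_set G j (j + p - 1)%N; [lia|lia|].
have [le eq] := num_edges_low cG lo cf cS leS j_gt0 jn.
have EG : (num_edges G)%:Z = edge_bound l r n ->
    in_Gclass l r n G \/ (4 <= r <= 7)%N /\ in_Hclass l r n G.
  rewrite boundE => -[/eq[[j1|[r47 gen]] [indS dS iso]]].
    left; split=> //; have /cards1P[v Sv] : #|S| == 1%N by rewrite cS j1.
    exists v; rewrite dS ?Sv ?set11 //; split; first by rewrite El j1; lia.
    by rewrite -subn1 -j1 -Sv.
  right; split=> //; split=> //; exists S, (n - j)%N.
  have nQ : n%:R = 2 * j%:R + p%:R :> rat by rewrite -gen natrD natrM.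
  split=> //.
  - by rewrite cS lQ nQ; lra.
  - move=> v /dS->; rewrite lQ nQ natrB ?natrD; [lra|lia].
  by rewrite lQ natrB ?nQ; [lra|lia].
split; first by rewrite boundE lez_nat.
  by move=> r38; split=> [/EG[//|[r47 _]]|]; [lia | apply: G_edges].
by move=> _; split; [apply: G_edges | move=> /EG[?|[_ ?]]; [left|right]].
Qed.
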